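(* Let $n,k$ be positive integers with $k>n$. For any $m\in\mathbb{N}$, we have \[\sum_{\emptyset\ne J\subset\{1,\ldots,n\}}(-1)^{\lvert J\rvert-1}S(m,J)=\frac{1}{m^k}.\]
   Context: $\mathbb{N}=\{1,2,\ldots\}$. For fixed $n,k\in\mathbb{N}$ with $k>n$ and $r\in\{1,\ldots,n\}$, \[I(r)=\bigl\{\mathbf{k}=(k_1,\ldots,k_n)\in\mathbb{N}^n \bigm| k_n\geq 2,\ k_1+\cdots+k_n=k,\ k_1=\cdots=k_{r-1}=1\bigr\}.\] For $m\in\mathbb{N}$ and a nonempty subset $J\subset\{1,\ldots,n\}$, \[M(m,J)=\Bigl\{\mathbf{m}=(m_1,\ldots,m_n)\in\mathbb{N}^n\Bigm|\sum_{j\in J}m_j=m\Bigr\},\] \[S(m,J)=\sum_{\mathbf{k}\in I(\max J)}\ \sum_{\mathbf{m}\in M(m,J)}\frac{1}{m_1^{k_1}(m_1+m_2)^{k_2}\cdots(m_1+\cdots+m_n)^{k_n}}.\] *)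

(* Defs.v *)
From mathcomp Require Import all_boot all_order all_algebra.
From mathcomp Require Import all_classical all_reals all_analysis.

Set Implicit Arguments.
Unset Strict Implicit.
Unset Printing Implicit Defensive.

Import Order.TTheory GRing.Theory Num.Theory.

Local Open Scope classical_set_scope.
Local Open Scope ring_scope.

(* Positions 1, ..., n are encoded by 'I_n, with i : 'I_n standing for
   position i.+1; r and max_pos J below are 1-based. *)

Definition index_set (n k r : nat) : set {ffun 'I_n -> nat} :=
  [set kk | [/\ forall i, (0 < kk i)%N,
                forall i : 'I_n, i.+1 = n -> (2 <= kk i)%N,
                (\sum_(i < n) kk i)%N = k
              & forall i : 'I_n, (i.+1 < r)%N -> kk i = 1%N]].

Definition max_pos (n : nat) (J : {set 'I_n}) : nat :=
  (\max_(j in J) j.+1)%N.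

Definition summation_set (n m : nat) (J : {set 'I_n}) :
    set {ffun 'I_n -> nat} :=
  [set mm | (forall i, (0 < mm i)%N) /\ (\sum_(j in J) mm j)%N = m].

Definition mzv_term (R : realType) (n : nat) (kk mm : {ffun 'I_n -> nat}) : R :=
  (\prod_(i < n) (\sum_(j < n | (j <= i)%N) mm j)%N%:R ^+ kk i)^-1.

(* The terms are nonnegative, so S(m, J) is well defined in [0, +oo]. In \bar R,
   -oo absorbs +oo under addition, so a finite alternating sum of such values
   is finite only if each of them is: an equation between such a sum and
   a real number includes the convergence of every series involved. *)
Definition S_sum (R : realType) (n k m : nat) (J : {set 'I_n}) : \bar R :=
  (\esum_(kk in @index_set n k (max_pos J))
     \esum_(mm in summation_set m J) (mzv_term R kk mm)%:E)%E.

(* Main.v *)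
(* Fix p = |J| and separate the entries of m = (m_1, ..., m_n) at the positions
   in J, with sum a, from the others, with sum b. Let
     alpha_p(a) = \sum_(0 < a_1 < ... < a_p = a) 1 / (a_1 ... a_p).
   For fixed a, b and k, with the factor 1 / (m_1 + ... + m_n)
   coming from k_n >= 2 set aside, the sum of the terms over all (J, k, m) is
     alpha_p(a) alpha_(n-p)(b) / a^s,    s = k - n - 1.
   This follows by induction on n, deleting the last position: below max J,
   where every k_i is 1, the recurrence is the partial-fraction shuffle of two
   chains, and from max J on it is the geometric sum
     a / (a+b)^(s+1) + b \sum_(d <= s) 1 / (a^d (a+b)^(s-d+1)) = 1 / a^s.
   Hence a = m leaves one infinite sum over b, which telescopes:
     \sum_b alpha_q(b) / (m+b) = h_q(1, ..., 1/m) / m.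
   Since m alpha_(p+1)(m) = e_p(1, ..., 1/(m-1)), the alternating sum over p is
   the duality between elementary and complete symmetric functions,
     \sum_p (-1)^p e_p(1, ..., 1/(m-1)) h_(n-1-p)(1, ..., 1/m) = 1 / m^(n-1).
   Until then every sum has nonnegative terms, so convergence comes for free. *)

Require Import Defs.
From mathcomp Require Import all_boot all_order all_algebra.
From mathcomp Require Import all_classical all_reals all_analysis.
From mathcomp Require Import zify ring.

Set Implicit Arguments.
Unset Strict Implicit.
Unset Printing Implicit Defensive.

Import Order.TTheory GRing.Theory Num.Theory.
Import numFieldNormedType.Exports.

Local Open Scope classical_set_scope.
Local Open Scope ring_scope.

(** * Sums of families with values in [0, +oo] *)

Section EsumTheory.
Context {R : realType}.
Local Open Scope ereal_scope.

Lemma esumZl (T : choiceType) (r : R) (a : T -> \bar R) :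
  (0 <= r)%R -> (forall i, 0 <= a i) ->
  \esum_(i in [set: T]) (r%:E * a i) = r%:E * \esum_(i in [set: T]) a i.
Proof.
move=> r_ge0 a_ge0; rewrite /esum -ereal_supZl//; last first.
  by apply/set0P; exists (\sum_(i \in set0) a i), set0 => //; exact: fsets_set0.
congr ereal_sup; apply/seteqP; split=> [x/= [A AD <-]|x/=].
  by exists (\sum_(i \in A) a i); [exists A | rewrite ge0_mule_fsumr].
by move=> [_ [A AD <-] <-]; exists A => //; rewrite ge0_mule_fsumr.
Qed.

Lemma esum_finType (T : finType) (P : pred T) (a : T -> \bar R) :
  (forall i, 0 <= a i) ->
  \esum_(i in [set i | P i]) a i = \sum_(i | P i) a i.
Proof.
move=> a_ge0; rewrite esum_fset//; last exact: finite_finset.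
rewrite [RHS]bigfs ?index_enum_uniq// => i _.
by rewrite mem_index_enum.
Qed.

Lemma exchange_esum (T1 T2 : choiceType) (a : T1 -> T2 -> \bar R) :
  (forall i j, 0 <= a i j) ->
  \esum_(i in [set: T1]) \esum_(j in [set: T2]) a i j =
  \esum_(j in [set: T2]) \esum_(i in [set: T1]) a i j.
Proof.
move=> a_ge0; rewrite !esum_esum//.
rewrite (reindex_esum ([set: T2] `*`` fun=> [set: T1]) _
  (fun x => (x.2, x.1)))//; split=> //=.
- by move=> [i1 i2] [j1 j2] /= _ _ [-> ->].
- by move=> [i j] _; exists (j, i).
Qed.

Lemma esumD2 (T1 T2 : choiceType) (a b : T1 -> T2 -> \bar R) :
  (forall i j, 0 <= a i j) -> (forall i j, 0 <= b i j) ->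
  \esum_(i in [set: T1]) \esum_(j in [set: T2]) (a i j + b i j) =
  \esum_(i in [set: T1]) \esum_(j in [set: T2]) a i j +
  \esum_(i in [set: T1]) \esum_(j in [set: T2]) b i j.
Proof.
move=> a_ge0 b_ge0; rewrite -esumD; [|by move=> i _; apply: esum_ge0..].
by apply: eq_esum => i _; rewrite esumD.
Qed.

Lemma esum_delta (T : choiceType) (t : T) (a : T -> \bar R) :
  0 <= a t -> \esum_(i in [set: T]) (if i == t then a i else 0) = a t.
Proof.
move=> at_ge0; rewrite -[RHS]esum_set1// [RHS]esum_mkcond.
apply: eq_esum => i _; congr (if _ then _ else _).
by apply/eqP/idP; rewrite inE.
Qed.

(** With e = i + j + c as summation variable in place of j, the remaining condition is i + c <= e.
    The truncated [e.+1 - c] counts these i and is 0 when e < c. *)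
Lemma esum_triangle (c : nat) (F : nat -> nat -> \bar R) :
  (forall i j, 0 <= F i j) ->
  \esum_(i in [set: nat]) \esum_(j in [set: nat]) F i (i + j + c)%N =
  \esum_(e in [set: nat]) \sum_(i < e.+1 - c) F i e.
Proof.
move=> F_ge0.
transitivity (\esum_(i in [set: nat]) \esum_(e in [set: nat])
    if (i + c <= e)%N then F i e else 0).
  apply: eq_esum => i _; pose D := [set e | (i + c <= e)%N].
  transitivity (\esum_(e in D) F i e).
    rewrite (reindex_esum setT D (fun j => i + j + c)%N)//.
    split=> [j _|x y _ _|e].
    - by rewrite /D/=; lia.
    - by move=> /=; lia.
    - by rewrite /D/= => h; exists (e - (i + c))%N => //; lia.
  rewrite esum_mkcond; apply: eq_esum => e _.
  by congr (if _ then _ else _); apply/idP/idP; rewrite inE.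
rewrite exchange_esum; last by move=> i j; case: ifP.
apply: eq_esum => e _; rewrite (@fsbig_ord _ _ _ _ (F^~ e)) -esum_fset//.
rewrite [RHS]esum_mkcond.
apply: eq_esum => i _; congr (if _ then _ else _).
by apply/idP/idP; rewrite inE/=; lia.
Qed.

Lemma esum_letter (a : bool * nat * nat -> \bar R) :
  (forall t, 0 <= a t) ->
  \esum_(t in [set: bool * nat * nat]) a t =
  \esum_(y in [set: nat]) \esum_(x in [set: nat])
    (a (true, x, y) + a (false, x, y)).
Proof.
move=> a_ge0.
transitivity (\esum_(y in [set: nat]) \esum_(x in [set: nat])
  \esum_(c in [set: bool]) a (c, x, y)).
  under [RHS]eq_esum do rewrite esum_esum//.
  rewrite esum_esum//.
  apply: (reindex_esum _ _ (fun u : nat * (nat * bool) => (u.2.2, u.2.1, u.1))).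
  split=> //=.
  - by move=> [y1 [x1 c1]] [y2 [x2 c2]] /= _ _ [-> -> ->].
  - by move=> [[c x] y] _; exists (y, (x, c)).
apply: eq_esum => y _; apply: eq_esum => x _.
have := @esum_finType _ xpredT (fun c => a (c, x, y)).
by rewrite set_true big_bool => ->.
Qed.

End EsumTheory.

(** * Functions on n + 1 positions as a prefix and a last value *)

Section FfunRcons.
Context {T : choiceType} {n : nat}.

Definition ffrcons (f : {ffun 'I_n -> T}) (t : T) : {ffun 'I_n.+1 -> T} :=
  [ffun i => oapp f t (unlift ord_max i)].

(** The embedding produced by [big_ord_recr] is [widen_ord], whereas [ffrcons] is defined through
    [lift ord_max]. *)
Lemma ffrcons_widen f t i : ffrcons f t (widen_ord (leqnSn n) i) = f i.
Proof.
have -> : widen_ord (leqnSn n) i = lift ord_max i.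
  by apply: val_inj; rewrite /= /bump leqNgt ltn_ord.
by rewrite ffunE liftK.
Qed.

Lemma ffrcons_max f t : ffrcons f t ord_max = t.
Proof. by rewrite ffunE unlift_none. Qed.

Lemma esum_ffun_recr (R : realType) (a : {ffun 'I_n.+1 -> T} -> \bar R) :
  (forall f, 0 <= a f)%E ->
  \esum_(f in [set: {ffun 'I_n.+1 -> T}]) a f =
  \esum_(f in [set: {ffun 'I_n -> T}]) \esum_(t in [set: T]) a (ffrcons f t).
Proof.
move=> a_ge0; rewrite esum_esum//.
apply: (reindex_esum _ _ (fun u : {ffun 'I_n -> T} * T => ffrcons u.1 u.2)).
split=> //.
- move=> [f t] [g s] _ _ /= fg; congr (_, _).
    by apply/ffunP => i; rewrite -(ffrcons_widen f t) fg ffrcons_widen.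
  by rewrite -(ffrcons_max f t) fg ffrcons_max.
- move=> f _; exists ([ffun i => f (widen_ord (leqnSn n) i)], f ord_max) => //=.
  apply/ffunP => i; rewrite ffunE; case: unliftP => [j|] -> //=.
  rewrite ffunE; congr (f _).
  by apply: val_inj; rewrite /= /bump leqNgt ltn_ord.
Qed.

End FfunRcons.

Lemma forall_ord_recr n (P : pred 'I_n.+1) :
  [forall i, P i] = [forall i, P (widen_ord (leqnSn n) i)] && P ord_max.
Proof.
apply/forallP/andP => [Pi|[/forallP Pi Pn] i].
  by split=> //; apply/forallP => i; exact: Pi.
case: (unliftP ord_max i) => [j|] -> //.
suff -> : lift ord_max j = widen_ord (leqnSn n) j by exact: Pi.
by apply: val_inj; rewrite /= /bump leqNgt ltn_ord.
Qed.

Lemma exists_ord_recr n (P : pred 'I_n.+1) :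
  [exists i, P i] = [exists i, P (widen_ord (leqnSn n) i)] || P ord_max.
Proof.
apply: negb_inj; rewrite negb_or !negb_exists.
exact: (forall_ord_recr (fun i => ~~ P i)).
Qed.

(** * Configurations and the effect of appending a position *)

Section Configurations.

(* Position i carries the triple (is it in J?, m_i - 1, k_i - 1), except that
   the last component is k_n - 2 at position n. *)
Definition config (n : nat) := {ffun 'I_n -> bool * nat * nat}.

Definition nbJ n (f : config n) : nat := (\sum_(i < n) (f i).1.1)%N.

Definition sumJ n (f : config n) : nat :=
  (\sum_(i < n | (f i).1.1) (f i).1.2.+1)%N.

Definition sumC n (f : config n) : nat :=
  (\sum_(i < n | ~~ (f i).1.1) (f i).1.2.+1)%N.

Definition excess n (f : config n) : nat := (\sum_(i < n) (f i).2)%N.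

(* [flat]: k_i = 1 at every position;
   [admissible]: J is nonempty and k_i = 1 for i < max J. *)
Definition flat n (f : config n) : bool := [forall i, (f i).2 == 0%N].

Definition admissible n (f : config n) : bool :=
  [exists i, (f i).1.1] &&
  [forall j, (f j).1.1 ==> [forall i : 'I_n, (i < j)%N ==> ((f i).2 == 0%N)]].

(** The exponent is k_i for i < n but k_n - 1 at position n. Setting one factor 1 / (m_1 + ... +
    m_n) aside makes all positions alike, as induction on n requires. *)
Definition weight (R : realType) n (f : config n) : R :=
  \prod_(i < n) ((\sum_(j < n | (j <= i)%N) (f j).1.2.+1)%:R ^+ (f i).2.+1)^-1.

Context (n : nat) (f : config n) (c : bool) (x y : nat).
Let g : config n.+1 := ffrcons f (c, x, y).

Lemma nbJ_rcons : nbJ g = (nbJ f + c)%N.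
Proof.
rewrite /nbJ big_ord_recr /= ffrcons_max /=.
by under eq_bigr do rewrite ffrcons_widen.
Qed.

Lemma sumJ_rcons : sumJ g = (sumJ f + if c then x.+1 else 0)%N.
Proof.
rewrite /sumJ big_mkcond big_ord_recr /= ffrcons_max /=.
by under eq_bigr do rewrite ffrcons_widen; rewrite -big_mkcond.
Qed.

Lemma sumC_rcons : sumC g = (sumC f + if c then 0 else x.+1)%N.
Proof.
rewrite /sumC big_mkcond big_ord_recr /= ffrcons_max /= if_neg.
by under eq_bigr do rewrite ffrcons_widen; rewrite -big_mkcond.
Qed.

Lemma excess_rcons : excess g = (excess f + y)%N.
Proof.
rewrite /excess big_ord_recr /= ffrcons_max /=.
by under eq_bigr do rewrite ffrcons_widen.
Qed.

Lemma flat_rcons : flat g = flat f && (y == 0%N).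
Proof.
rewrite /flat forall_ord_recr ffrcons_max /=; congr andb.
by apply: eq_forallb => i; rewrite ffrcons_widen.
Qed.

(** A last position in J becomes max J, so every earlier k_i must be 1. Otherwise max J is
    unchanged. In both cases the last exponent is free. *)
Lemma admissible_rcons : admissible g = if c then flat f else admissible f.
Proof.
rewrite /admissible exists_ord_recr forall_ord_recr ffrcons_max /=.
have -> : [forall i : 'I_n.+1, (i < n)%N ==> ((g i).2 == 0%N)] = flat f.
  rewrite forall_ord_recr /= ltnn /= andbT; apply: eq_forallb => i.
  by rewrite ltn_ord ffrcons_widen.
have -> : [exists i, (g (widen_ord (leqnSn n) i)).1.1] = [exists i, (f i).1.1].
  by apply: eq_existsb => i; rewrite ffrcons_widen.
have -> : [forall i : 'I_n, (g (widen_ord (leqnSn n) i)).1.1 ==>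
    [forall j : 'I_n.+1, (j < i)%N ==> ((g j).2 == 0%N)]] =
    [forall i : 'I_n, (f i).1.1 ==>
    [forall j : 'I_n, (j < i)%N ==> ((f j).2 == 0%N)]].
  apply: eq_forallb => i; rewrite ffrcons_widen forall_ord_recr /=.
  rewrite [(n < i)%N]ltnNge ltnW//= andbT; congr (_ ==> _).
  by apply: eq_forallb => j; rewrite ffrcons_widen.
case: c; rewrite ?orbT ?orbF ?andbT//=.
apply/andP/idP => [[]//|flatf]; split=> //.
apply/forallP => i; apply/implyP => _; apply/forallP => j; apply/implyP => _.
exact: (forallP flatf).
Qed.

Lemma sum_config n' (h : config n') :
  (\sum_(i < n') (h i).1.2.+1)%N = (sumJ h + sumC h)%N.
Proof. by rewrite (bigID (fun i => (h i).1.1)). Qed.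

Lemma weight_rcons (R : realType) :
  weight R g = weight R f * ((sumJ f + sumC f + x.+1)%:R ^+ y.+1)^-1.
Proof.
rewrite /weight big_ord_recr /= ffrcons_max /=; congr (_ * (_%:R ^+ _)^-1).
  apply: eq_bigr => i _; rewrite ffrcons_widen; congr (_%:R ^+ _)^-1.
  rewrite big_mkcond big_ord_recr /= [(n <= i)%N]leqNgt ltn_ord addn0.
  by under eq_bigr do rewrite ffrcons_widen; rewrite -big_mkcond.
rewrite -sum_config big_mkcond big_ord_recr /= leqnn ffrcons_max; congr addn.
by apply: eq_bigr => i _; rewrite (ltnW (ltn_ord i)) ffrcons_widen.
Qed.

Lemma weight_ge0 (R : realType) n' (h : config n') : 0 <= weight R h.
Proof. by apply: prodr_ge0 => i _; rewrite invr_ge0 exprn_ge0. Qed.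

End Configurations.

(** * The nested sums alpha_p(a) *)

Section ChainSums.
Context {R : realType}.

(* The alpha_p(a) of the header; the junk value at a = 0 is 0 for p > 0. *)
Fixpoint chain_sum (p a : nat) : R :=
  if p is q.+1 then (\sum_(c < a) chain_sum q c) / a%:R else (a == 0%N)%:R.

Lemma chain_sum_ge0 p a : 0 <= chain_sum p a.
Proof.
by elim: p a => [|p IHp] a //=; rewrite divr_ge0// sumr_ge0.
Qed.

Lemma chain_sum0 a : chain_sum 0 a = (a == 0%N)%:R.
Proof. by []. Qed.

Lemma chain_sumS0 p : chain_sum p.+1 0 = 0.
Proof. by rewrite /= big_ord0 mul0r. Qed.

Lemma mul_chain_sumS p a :
  a%:R * chain_sum p.+1 a = \sum_(c < a) chain_sum p c.
Proof.
case: a => [|a]; first by rewrite mul0r big_ord0.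
by rewrite /= mulrC divfK// pnatr_eq0.
Qed.

(** [chain_sum 0] is supported at 0; this makes the boundary terms of the recurrences below
    vanish. *)
Lemma mul_chain_sum0 a : a%:R * chain_sum 0 a = 0.
Proof. by case: a => [|a] /=; rewrite ?mul0r ?mulr0. Qed.

End ChainSums.

Arguments chain_sum : simpl never.

Ltac nneg := repeat first
  [ done
  | apply: chain_sum_ge0 | apply: weight_ge0
  | apply: esum_ge0 => ? _ | apply: sume_ge0 => ? _ | apply: mule_ge0
  | apply: adde_ge0
  | apply: sumr_ge0 => ? _ | apply: addr_ge0
  | rewrite lee_fin | apply: mulr_ge0 | rewrite invr_ge0 | apply: exprn_ge0
  | case: ifP => _ | move=> ? ].

(** * Flat configurations: the shuffle of two chains *)

Section ConfigurationSums.
Context {R : realType}.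
Local Open Scope ereal_scope.

(** Here a is the sum of the old entries, x + 1 the appended entry and e the new sum. Collecting all
    a < e yields the inner sum of the recurrence for [chain_sum]. *)
Lemma esum_append (u : nat -> R) (G : nat -> \bar R) :
  (forall a, 0 <= u a)%R -> (forall e, 0 <= G e) ->
  \esum_(a in [set: nat]) ((u a)%:E * \esum_(x in [set: nat]) G (a + x.+1)%N) =
  \esum_(e in [set: nat]) ((\sum_(a < e) u a)%:E * G e).
Proof.
move=> u_ge0 G_ge0; pose F a e := (u a)%:E * G e.
transitivity (\esum_(a in [set: nat]) \esum_(x in [set: nat])
    F a (a + x + 1)%N).
  apply: eq_esum => a _; rewrite -esumZl//.
  by apply: eq_esum => x _; rewrite addn1 addnS.
rewrite esum_triangle; last by rewrite /F; nneg.
apply: eq_esum => e _; rewrite subn1 /F -ge0_sume_distrl ?sumEFin//.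
by move=> i _; rewrite lee_fin.
Qed.

(** Since g is arbitrary, the induction on n can absorb the last position into it. The last position
    lies in J or outside it, with shares a / (a+b) and b / (a+b), whose sum is 1. *)
Lemma esum_flat n (g : nat -> nat -> nat -> \bar R) :
  (forall p a b, 0 <= g p a b) ->
  \esum_(f in [set: config n])
    (if flat f then (weight R f)%:E * g (nbJ f) (sumJ f) (sumC f) else 0) =
  \sum_(p < n.+1) \esum_(a in [set: nat]) \esum_(b in [set: nat])
    ((chain_sum p a * chain_sum (n - p) b)%:E * g p a b).
Proof.
elim: n g => [|n IHn] g g_ge0.
  have f0 : [set: config 0] = [set [ffun=> (false, 0%N, 0%N)]].
    by apply/seteqP; split=> // f _ /=; apply/ffunP => -[].
  rewrite f0 esum_set1; last by nneg.
  rewrite ifT; last by apply/forallP => -[].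
  rewrite big_ord_recl big_ord0 adde0.
  rewrite /weight /nbJ /sumJ /sumC !big_ord0 mul1e.
  rewrite -(esum_delta (t := 0%N) (a := fun a => g 0%N a 0%N))//.
  apply: eq_esum => a _.
  rewrite -(esum_delta (t := 0%N) (a := fun b => g 0%N a b))//.
  case: eqVneq => [->|a_neq0].
    apply: eq_esum => b _; rewrite !chain_sum0 mul1r.
    by case: eqP; rewrite ?mul1e ?mul0e.
  by rewrite esum1// => b _; rewrite chain_sum0 (negPf a_neq0) mul0r mul0e.
(* The two summands of [k] put the last entry x + 1 into J or outside it; [g'] sums them with the
   last denominator, whose exponent is 1 by flatness. *)
pose k p a b x := g p.+1 (a + x.+1)%N b + g p a (b + x.+1)%N.
pose g' p a b :=
  \esum_(x in [set: nat]) (((a + b + x.+1)%:R^-1)%:E * k p a b x).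
have k_ge0 p a b x : 0 <= k p a b x by exact: adde_ge0.
have g'_ge0 p a b : 0 <= g' p a b by rewrite /g'; nneg.
transitivity (\esum_(f in [set: config n])
    (if flat f then (weight R f)%:E * g' (nbJ f) (sumJ f) (sumC f) else 0)).
  rewrite esum_ffun_recr; last by nneg.
  apply: eq_esum => f _; rewrite esum_letter; last by nneg.
  under eq_esum => y _ do under eq_esum => x _ do
    rewrite !flat_rcons !nbJ_rcons !sumJ_rcons !sumC_rcons !weight_rcons
      ?addn1 ?addn0.
  case: ifP => flatf /=; last first.
    by rewrite esum1// => y _; rewrite esum1// => x _; rewrite adde0.
  rewrite /g' -esumZl; [|exact: weight_ge0|by nneg].
  transitivity (\esum_(y in [set: nat]) (if y == 0%N then
      \esum_(x in [set: nat]) ((weight R f)%:E *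
      (((sumJ f + sumC f + x.+1)%:R ^+ y.+1)^-1%:E *
        k (nbJ f) (sumJ f) (sumC f) x)) else 0)); last first.
    by rewrite esum_delta; last by nneg.
  apply: eq_esum => y _; case: ifP => y0; last first.
    by rewrite esum1// => x _; rewrite adde0.
  apply: eq_esum => x _; rewrite !EFinM -!muleA -!ge0_muleDr//; nneg.
rewrite IHn//.
pose T (u : nat -> nat -> R) p : \bar R :=
  \esum_(a in [set: nat]) \esum_(b in [set: nat])
    ((u a b * chain_sum p a * chain_sum (n.+1 - p) b)%R%:E * g p a b).
(* The shares of a last position in J and outside J; the numerators come from [mul_chain_sumS]. *)
pose u1 a b : R := (a%:R / (a + b)%:R)%R.
pose u2 a b : R := (b%:R / (a + b)%:R)%R.
transitivity (\sum_(p < n.+1) (T u1 p.+1 + T u2 p)).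
  apply: eq_bigr => -[p /= p_le] _; rewrite /g' /k.
  transitivity (\esum_(a in [set: nat]) \esum_(b in [set: nat])
    (((chain_sum p a * chain_sum (n - p) b)%:E * \esum_(x in [set: nat])
        ((((a + x.+1) + b)%:R^-1)%:E * g p.+1 (a + x.+1)%N b)) +
     ((chain_sum p a * chain_sum (n - p) b)%:E * \esum_(x in [set: nat])
        (((a + (b + x.+1))%:R^-1)%:E * g p a (b + x.+1)%N)))).
    apply: eq_esum => a _; apply: eq_esum => b _.
    rewrite -ge0_muleDr; [|by nneg..]; rewrite -esumD; [|by nneg..].
    congr (_ * _); apply: eq_esum => x _.
    by rewrite ge0_muleDr// addnA addnAC.
  rewrite esumD2; [|by nneg..]; congr (_ + _).
    rewrite exchange_esum; last by nneg.
    rewrite /T [RHS]exchange_esum; last by rewrite /u1; nneg.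
    apply: eq_esum => b _.
    rewrite [LHS](esum_append
      (u := fun a => (chain_sum p a * chain_sum (n - p) b)%R)
      (G := fun e => ((e + b)%:R^-1)%:E * g p.+1 e b)); [|by nneg..].
    apply: eq_esum => a _; rewrite -mulr_suml -mul_chain_sumS muleA -EFinM.
    by congr (_%:E * _); rewrite subSS /u1; ring.
  apply: eq_esum => a _.
  rewrite [LHS](esum_append
    (u := fun b => (chain_sum p a * chain_sum (n - p) b)%R)
    (G := fun e => ((a + e)%:R^-1)%:E * g p a e)); [|by nneg..].
  apply: eq_esum => b _; rewrite -mulr_sumr -mul_chain_sumS muleA -EFinM.
  by congr (_%:E * _); rewrite subSn// /u2; ring.
(* A last position in J raises p by one. The ranges are aligned by adding the terms [T u1 0] and
   [T u2 n.+1], both zero. *)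
transitivity (\sum_(p < n.+2) (T u1 p + T u2 p)).
  rewrite !big_split /= [in RHS]big_ord_recl.
  rewrite [X in _ = _ + X]big_ord_recr /=.
  have -> : T u1 0%N = 0.
    rewrite /T esum1// => a _; rewrite esum1// => b _.
    by rewrite /u1 (mulrAC a%:R) mul_chain_sum0 !mul0r mul0e.
  have -> : T u2 n.+1 = 0.
    rewrite /T esum1// => a _; rewrite esum1// => b _.
    rewrite subnn /u2 mulrAC (mulrAC b%:R) mul_chain_sum0.
    by rewrite !mul0r mul0e.
  by rewrite add0e adde0.
apply: eq_bigr => -[p /= p_lt] _.
rewrite /T -esumD2; [|by rewrite /u1 /u2; nneg..].
apply: eq_esum => a _; apply: eq_esum => b _.
rewrite -ge0_muleDl; [|by rewrite /u1 /u2; nneg..].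
rewrite -EFinD -!mulrA -mulrDl; congr (_%:E * _).
(* At a = b = 0 the shares do not add up to 1, but p or n + 1 - p is positive, so one chain sum
   vanishes. *)
have [ab0|ab_gt0] := posnP (a + b)%N.
  have -> : a = 0%N by lia.
  have -> : b = 0%N by lia.
  have -> : (chain_sum p 0 * chain_sum (n.+1 - p) 0 = 0 :> R)%R.
    case: p p_lt => [|p] p_lt; last by rewrite chain_sumS0 mul0r.
    by rewrite chain_sumS0 mulr0.
  by rewrite !mulr0.
by rewrite !mulrA -natrD divff ?mul1r// pnatr_eq0 -lt0n.
Qed.

End ConfigurationSums.

(** * Admissible configurations: the geometric sum *)

Lemma flat_excess n (f : config n) : flat f -> excess f = 0%N.
Proof.
by move=> /forallP flatf; rewrite /excess big1// => i _; apply/eqP/flatf.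
Qed.

(** With c = a + b and b = c - a, this is the factorization of 1/c^(s+1) - 1/a^(s+1) by 1/c -
    1/a. *)
Lemma geometric_split (R : realType) (a b s : nat) : (0 < a)%N ->
  a%:R / (a + b)%:R ^+ s.+1 +
    b%:R * \sum_(d < s.+1) (a%:R ^+ d)^-1 * ((a + b)%:R ^+ (s - d).+1)^-1 =
  (a%:R ^+ s)^-1 :> R.
Proof.
move=> a_gt0; set c := (a + b)%:R.
have a_neq0 : a%:R != 0 :> R by rewrite pnatr_eq0 -lt0n.
have c_neq0 : c != 0 by rewrite pnatr_eq0 addn_eq0 negb_and -lt0n a_gt0.
have -> : b%:R = c - a%:R :> R by rewrite /c natrD addrAC subrr add0r.
set S := \sum_(d < s.+1) c^-1 ^+ (s - d) * a%:R^-1 ^+ d.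
have -> : \sum_(d < s.+1) (a%:R ^+ d)^-1 * (c ^+ (s - d).+1)^-1 = S / c.
  rewrite mulr_suml; apply: eq_bigr => d _.
  by rewrite exprS invfM -!exprVn; ring.
have -> : (c - a%:R) * (S / c) = - (a%:R * ((c^-1 - a%:R^-1) * S)).
  by field; rewrite a_neq0 -natrD.
have <- : _ = (c^-1 - a%:R^-1) * S := subrXX c^-1 a%:R^-1 s.+1.
rewrite -!exprVn mulrBr [a%:R * a%:R^-1 ^+ _]mulrC.
by rewrite [a%:R^-1 ^+ s.+1]exprSr mulfVK//; ring.
Qed.

Section AdmissibleSums.
Context {R : realType}.
Local Open Scope ereal_scope.

(** Induction on n: if the last position is in J, the prefix is flat and [esum_flat] applies; if
    not, the prefix is admissible and the induction hypothesis applies. The two shares add up to 1 /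
    a^s by [geometric_split]. *)
Lemma esum_admissible n (g : nat -> nat -> nat -> nat -> \bar R) :
  (forall p d a b, 0 <= g p d a b) ->
  \esum_(f in [set: config n])
    (if admissible f then
       (weight R f)%:E * g (nbJ f) (excess f) (sumJ f) (sumC f) else 0) =
  \sum_(p < n)
    \esum_(a in [set: nat]) \esum_(b in [set: nat]) \esum_(s in [set: nat])
      ((chain_sum p.+1 a * chain_sum (n - p.+1) b / a%:R ^+ s)%:E *
        g p.+1 s a b).
Proof.
elim: n g => [|n IHn] g g_ge0.
  rewrite big_ord0 esum1// => f _; rewrite ifF//.
  by apply/negbTE/negP => /andP[/existsP[[]]].
(* [g1] is for a last position in J, whose y is the whole excess; [g2] is for one outside J, whose y
   adds to the earlier excess d. *)
pose g1 p a b := \esum_(x in [set: nat]) \esum_(y in [set: nat])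
  ((((a + x.+1) + b)%:R ^- y.+1)%:E * g p.+1 y (a + x.+1)%N b).
pose g2 p d a b := \esum_(x in [set: nat]) \esum_(y in [set: nat])
  (((a + (b + x.+1))%:R ^- y.+1)%:E * g p (d + y)%N a (b + x.+1)%N).
have g1_ge0 p a b : 0 <= g1 p a b by rewrite /g1; nneg.
have g2_ge0 p d a b : 0 <= g2 p d a b by rewrite /g2; nneg.
transitivity (\esum_(f in [set: config n])
   ((if flat f then (weight R f)%:E * g1 (nbJ f) (sumJ f) (sumC f) else 0) +
    (if admissible f then
       (weight R f)%:E * g2 (nbJ f) (excess f) (sumJ f) (sumC f) else 0))).
  rewrite esum_ffun_recr; last by nneg.
  apply: eq_esum => f _; rewrite esum_letter; last by nneg.
  rewrite exchange_esum; last by nneg.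
  under eq_esum => x _ do under eq_esum => y _ do
    rewrite !admissible_rcons !nbJ_rcons !sumJ_rcons !sumC_rcons !excess_rcons
      !weight_rcons ?addn1 ?addn0 /=.
  rewrite esumD2; [|by nneg..]; congr (_ + _).
    case: ifP => flatf; last by rewrite esum1// => x _; rewrite esum1.
    rewrite /g1 -esumZl; [|exact: weight_ge0|by nneg].
    apply: eq_esum => x _; rewrite -esumZl; [|exact: weight_ge0|by nneg].
    apply: eq_esum => y _.
    by rewrite flat_excess// EFinM -muleA addnAC.
  case: ifP => admf; last by rewrite esum1// => x _; rewrite esum1.
  rewrite /g2 -esumZl; [|exact: weight_ge0|by nneg].
  apply: eq_esum => x _; rewrite -esumZl; [|exact: weight_ge0|by nneg].
  by apply: eq_esum => y _; rewrite EFinM -muleA addnA.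
rewrite esumD; [|by nneg..]; rewrite esum_flat// IHn//.
pose T (u : nat -> nat -> nat -> R) p : \bar R :=
  \esum_(a in [set: nat]) \esum_(b in [set: nat]) \esum_(s in [set: nat])
    ((u a b s * (chain_sum p.+1 a * chain_sum (n - p) b))%R%:E * g p.+1 s a b).
pose u1 a b s : R := (a%:R / (a + b)%:R ^+ s.+1)%R.
pose u2 a b s : R := (b%:R * \sum_(d < s.+1)
  (a%:R ^+ d)^-1 * ((a + b)%:R ^+ (s - d).+1)^-1)%R.
have u1_ge0 a b s : (0 <= u1 a b s)%R by rewrite /u1; nneg.
have u2_ge0 a b s : (0 <= u2 a b s)%R by rewrite /u2; nneg.
transitivity (\sum_(p < n.+1) T u1 p + \sum_(p < n) T u2 p).
  congr (_ + _); apply: eq_bigr => -[p /= p_lt] _.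
    rewrite exchange_esum; last by nneg.
    rewrite /T [RHS]exchange_esum; last by nneg.
    apply: eq_esum => b _.
    rewrite [LHS](esum_append
      (u := fun a => (chain_sum p a * chain_sum (n - p) b)%R)
      (G := fun e => \esum_(y in [set: nat])
         ((e + b)%:R ^- y.+1)%:E * g p.+1 y e b)); [|by nneg..].
    apply: eq_esum => a _; rewrite -mulr_suml -mul_chain_sumS.
    rewrite -esumZl; [|by nneg..]; apply: eq_esum => s _.
    by rewrite muleA -EFinM /u1; congr (_%:E * _); ring.
  apply: eq_esum => a _.
  rewrite exchange_esum; last by nneg.
  transitivity (\esum_(d in [set: nat]) \esum_(b in [set: nat])
    ((b%:R * (chain_sum p.+1 a * chain_sum (n - p) b) / a%:R ^+ d)%R%:E *
      \esum_(y in [set: nat]) ((a + b)%:R ^- y.+1)%:E * g p.+1 (d + y)%N a b)).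
    apply: eq_esum => d _.
    rewrite [LHS](esum_append
      (u := fun b => (chain_sum p.+1 a * chain_sum (n - p.+1) b / a%:R ^+ d)%R)
      (G := fun e => \esum_(y in [set: nat])
         ((a + e)%:R ^- y.+1)%:E * g p.+1 (d + y)%N a e)); [|by nneg..].
    apply: eq_esum => b _; rewrite -mulr_suml -mulr_sumr -mul_chain_sumS.
    by congr (_%:E * _); rewrite -subSn// subSS; ring.
  rewrite exchange_esum; last by nneg.
  apply: eq_esum => b _.
  (* For total excess s = d + y, the last exponent y + 1 is s - d + 1, and d runs from 0 to s. *)
  pose F d s := ((b%:R * (chain_sum p.+1 a * chain_sum (n - p) b) / a%:R ^+ d
    / (a + b)%:R ^+ (s - d).+1)%R%:E * g p.+1 s a b).
  transitivity (\esum_(d in [set: nat]) \esum_(y in [set: nat])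
      F d (d + y + 0)%N).
    apply: eq_esum => d _; rewrite -esumZl; [|by nneg..].
    by apply: eq_esum => y _; rewrite /F addn0 addKn muleA -EFinM.
  rewrite esum_triangle; last by rewrite /F; nneg.
  apply: eq_esum => s _; rewrite subn0 /F -ge0_sume_distrl; last by nneg.
  rewrite sumEFin /u2; congr (_%:E * _).
  rewrite [RHS]mulrAC [RHS]mulr_sumr; apply: eq_bigr => d _; ring.
(* Only the term [T u2 n] is added; it is zero because it contains b times [chain_sum 0 b]. *)
transitivity (\sum_(p < n.+1) (T u1 p + T u2 p)).
  rewrite big_split /=; congr (_ + _); rewrite big_ord_recr /=.
  rewrite [X in _ + X](_ : _ = 0) ?adde0//.
  rewrite /T esum1// => a _; rewrite esum1// => b _; rewrite esum1// => s _.
  rewrite subnn /u2 (mulrC (chain_sum n.+1 a)) mulrACA.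
  by rewrite mul_chain_sum0 mul0r mul0e.
apply: eq_bigr => -[p /= p_lt] _; rewrite /T subSS.
rewrite -esumD2; [|by nneg..].
apply: eq_esum => a _; apply: eq_esum => b _; rewrite -esumD; [|by nneg..].
apply: eq_esum => s _; rewrite -ge0_muleDl; [|by nneg..].
rewrite -EFinD -mulrDl; congr (_%:E * _).
have [->|a_gt0] := posnP a; first by rewrite chain_sumS0 !(mul0r, mulr0).
by rewrite /u1 /u2 geometric_split// mulrC.
Qed.

End AdmissibleSums.

(** * Symmetric functions of 1, 1/2, ..., 1/m and the telescoping series *)

Section CompleteSymmetric.
Context {R : realType}.

(* h_q(1, 1/2, ..., 1/m) *)
Fixpoint complete_sum (q m : nat) : R :=
  if q is q'.+1 then \sum_(j < m) complete_sum q' j.+1 / j.+1%:R else 1.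

Lemma complete_sum0 m : complete_sum 0 m = 1.
Proof. by []. Qed.

Lemma complete_sumS0 q : complete_sum q.+1 0 = 0.
Proof. exact: big_ord0. Qed.

Lemma complete_sum_recr q m :
  complete_sum q.+1 m.+1 =
  complete_sum q.+1 m + complete_sum q m.+1 / m.+1%:R.
Proof. by rewrite /= big_ord_recr. Qed.

(* e_p(1, 1/2, ..., 1/m), grouped by the largest index in each product *)
Definition elementary_sum (p m : nat) : R := \sum_(c < m.+1) chain_sum p c.

Lemma elementary_sum0 m : elementary_sum 0 m = 1.
Proof.
by rewrite /elementary_sum big_ord_recl big1 ?addr0.
Qed.

Lemma elementary_sumS0 p : elementary_sum p.+1 0 = 0.
Proof. by rewrite /elementary_sum big_ord1 chain_sumS0. Qed.

Lemma chain_sumSS p m : chain_sum p.+1 m.+1 = elementary_sum p m / m.+1%:R.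
Proof. by []. Qed.

Lemma elementary_sum_recr p m :
  elementary_sum p.+1 m.+1 =
  elementary_sum p.+1 m + elementary_sum p m / m.+1%:R.
Proof. by rewrite /elementary_sum big_ord_recr. Qed.

Arguments complete_sum : simpl never.

(** In generating functions, [O] is the coefficient of t^n in E_m(-t) H_m(t) and [A] that in E_m(-t)
    H_(m+1)(t). The two splittings below add the variable 1/(m+1) to H and to E respectively. *)
Let A n m : R :=
  \sum_(p < n.+1) (-1) ^+ p * elementary_sum p m * complete_sum (n - p) m.+1.
Let O n m : R :=
  \sum_(p < n.+1) (-1) ^+ p * elementary_sum p m * complete_sum (n - p) m.

Let A_split n m : A n.+1 m = O n.+1 m + A n m / m.+1%:R.
Proof.
rewrite /A /O big_ord_recr [in RHS]big_ord_recr /= subnn !complete_sum0.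
rewrite addrAC mulr_suml -big_split; congr (_ + _).
apply: eq_bigr => -[p /= pn] _.
by rewrite subSn// complete_sum_recr; ring.
Qed.

Let O_split n m : O n.+1 m.+1 = A n.+1 m - A n m / m.+1%:R.
Proof.
rewrite /A /O big_ord_recl [in RHS]big_ord_recl !elementary_sum0 -addrA.
congr (_ + _); rewrite mulr_suml -sumrB; apply: eq_bigr => -[p /= pn] _.
by rewrite /bump leq0n add1n elementary_sum_recr subSS exprS; ring.
Qed.

(** The two splittings combine to [O n.+1 m.+1 = O n.+1 m]. At m = 0 there are no variables, and
    each product has a factor of positive degree. *)
Let O_eq0 n m : O n.+1 m = 0.
Proof.
elim: m => [|m IHm]; last by rewrite O_split A_split IHm; ring.
rewrite /O big1// => -[[|p] /= pn] _; last first.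
  by rewrite elementary_sumS0 mulr0 mul0r.
by rewrite subn0 complete_sumS0 mulr0.
Qed.

Lemma sum_elementary_complete n m :
  \sum_(p < n.+1) (-1) ^+ p * elementary_sum p m * complete_sum (n - p) m.+1 =
  (m.+1%:R ^+ n)^-1.
Proof.
rewrite -/(A n m); elim: n => [|n IHn].
  by rewrite /A big_ord1 elementary_sum0 subnn complete_sum0 !mul1r expr0 invr1.
by rewrite A_split O_eq0 add0r IHn exprSr invfM.
Qed.

Local Open Scope ereal_scope.

(** With E = c + x + 1, the summand is (1/E - 1/(E+m)) / m. It is the increment of f(x) = - \sum_(j
    < m) 1 / (m (j+1+c+x)), which increases to 0, so the series equals -f(0). *)
Lemma esum_telescope (c m : nat) : (0 < m)%N ->
  \esum_(x in [set: nat])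
    (((c + x.+1)%:R * (m + (c + x.+1))%:R)^-1 : R)%:E =
  (\sum_(j < m) (j.+1 + c)%:R^-1 / m%:R)%:E.
Proof.
move=> m_gt0; pose f x : R := (- \sum_(j < m) (j.+1 + c + x)%:R^-1 / m%:R)%R.
have f0 : (f x @[x --> \oo] --> (0 : R))%R.
  rewrite -oppr0; apply: cvgN.
  rewrite [X in _ --> X](_ : _ = \sum_(j < m) (0 / m%:R))%R; last first.
    by rewrite big1// => j _; rewrite mul0r.
  have := @cvg_big R 'I_m +%R 0%R xpredT add_continuous nat \oo
    (index_enum 'I_m)
    (fun j x => ((j.+1 + c + x)%:R^-1 / m%:R)%R) (fun j => (0 / m%:R)%R) _.
  apply => j _.
    apply: cvgMr_tmp; have := @cvg_harmonic R.
    rewrite -(cvg_shiftn (j + c)); apply: cvg_trans.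
    apply: near_eq_cvg; apply: nearW => x /=.
    by congr (_%:R^-1)%R; lia.
have df x : ((f x.+1 - f x)%R = ((c + x.+1)%:R * (m + (c + x.+1))%:R)^-1)%R.
  rewrite /f opprK addrC -sumrB.
  under eq_bigr do rewrite -mulrBl.
  rewrite -mulr_suml.
  rewrite -(big_mkord xpredT (fun j =>
    ((j.+1 + c + x)%:R^-1 - (j.+1 + c + x.+1)%:R^-1)%R)).
  pose h j : R := (- (j.+1 + c + x)%:R^-1)%R.
  have -> : (\sum_(0 <= j < m)
      ((j.+1 + c + x)%:R^-1 - (j.+1 + c + x.+1)%:R^-1) =
     \sum_(0 <= j < m) (h j.+1 - h j) :> R)%R.
    apply: eq_bigr => j _; rewrite /h opprK [RHS]addrC.
    by congr (_ - _%:R^-1)%R; lia.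
  rewrite telescope_sumr// /h opprK.
  have -> : (m.+1 + c + x = m + (c + x.+1))%N by lia.
  have -> : (1 + c + x = c + x.+1)%N by lia.
  rewrite natrD; set e := (c + x.+1)%:R.
  have e_gt0 : (0 < e)%R by rewrite ltr0n; lia.
  have m_gt0' : (0 < m%:R :> R)%R by rewrite ltr0n.
  by field; rewrite !gt_eqF// addr_gt0.
have fE : limn (EFin \o f) = 0.
  by apply/cvg_lim => //; apply: cvg_EFin => //; exact: nearW.
transitivity (\sum_(x <oo) ((f x.+1)%:E - (f x)%:E)).
  rewrite nneseries_esumT; last first.
    by move=> x; rewrite -EFinB df lee_fin invr_ge0 mulr_ge0.
  by apply: eq_esum => x _; rewrite -EFinB df.
have := @nondecreasing_telescope_sumey R 0%N f; rewrite fE => -> //.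
  rewrite sub0e -EFinN /f opprK; congr EFin.
  by apply: eq_bigr => j _; rewrite addn0.
by apply/nondecreasing_seqP => x; rewrite -subr_ge0 df invr_ge0 mulr_ge0.
Qed.

(** Induction on q for all m at once. Opening the last link b of the chain leaves a sum of 1 / (b
    (m+b)) over b > c; its telescoped value is a sum of 1 / (m (j+c)) over 1 <= j <= m, which gives
    the same series for q - 1 with j in place of m. *)
Lemma esum_chain_sum (q m : nat) : (0 < m)%N ->
  \esum_(b in [set: nat]) (chain_sum q b / (m + b)%:R : R)%:E =
  (complete_sum q m / m%:R)%:E.
Proof.
elim: q m => [|q IHq] m m_gt0.
  rewrite complete_sum0 mul1r -[in RHS](addn0 m).
  rewrite -(esum_delta (t := 0%N) (a := fun b => ((m + b)%:R^-1)%:E));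
    last by nneg.
  apply: eq_esum => b _; rewrite chain_sum0.
  by case: eqP; rewrite ?mul1r ?mul0r.
transitivity (\esum_(b in [set: nat]) ((\sum_(c < b) chain_sum q c)%R%:E *
    ((b%:R * (m + b)%:R)^-1 : R)%:E)).
  apply: eq_esum => b _; rewrite -EFinM; congr EFin.
  rewrite -mul_chain_sumS; case: b => [|b].
    by rewrite chain_sumS0 mulr0 !mul0r.
  by field; rewrite nat1r -natrD !pnatr_eq0 addnS.
transitivity (\esum_(c in [set: nat]) ((chain_sum q c)%:E *
    \esum_(x in [set: nat])
      (((c + x.+1)%:R * (m + (c + x.+1))%:R)^-1 : R)%:E)).
  by apply/esym/(esum_append
    (G := fun e => ((e%:R * (m + e)%:R)^-1 : R)%:E)); nneg.
under eq_esum => c _ do rewrite esum_telescope//.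
transitivity (\esum_(c in [set: nat]) \sum_(j < m)
   (m%:R^-1 : R)%:E * (chain_sum q c / (j.+1 + c)%:R)%:E).
  apply: eq_esum => c _; rewrite -EFinM.
  under [RHS]eq_bigr do rewrite -EFinM.
  rewrite sumEFin mulr_sumr; congr EFin; apply: eq_bigr => j _; ring.
rewrite esum_sum; last by nneg.
under eq_bigr => j _ do (rewrite esumZl; [|by nneg..]).
under eq_bigr => j _ do rewrite IHq// -EFinM.
rewrite sumEFin -mulr_sumr mulrC.
by [].
Qed.

End CompleteSymmetric.

Arguments complete_sum : simpl never.

(** * Correspondence between configurations and triples (J, k, m) *)

Section Encoding.
Context (n : nat).

Definition config_J (f : config n) : {set 'I_n} := [set i | (f i).1.1]%SET.

Definition config_k (f : config n) : {ffun 'I_n -> nat} :=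
  [ffun i => ((f i).2 + 1 + (i.+1 == n))%N].

Definition config_m (f : config n) : {ffun 'I_n -> nat} :=
  [ffun i => (f i).1.2.+1].

Lemma card_config_J f : #|config_J f| = nbJ f.
Proof.
rewrite -sum1_card /nbJ big_mkcond; apply: eq_bigr => i _.
by rewrite inE; case: (f i).1.1.
Qed.

Lemma sum_config_k f : (0 < n)%N ->
  (\sum_(i < n) config_k f i)%N = (excess f + n.+1)%N.
Proof.
move=> n_gt0; under eq_bigr do rewrite ffunE.
rewrite !big_split /= sum_nat_const card_ord muln1 -addnA; congr addn.
rewrite -addn1; congr addn.
have last_lt : (n.-1 < n)%N by rewrite prednK.
rewrite (bigD1 (Ordinal last_lt))//= prednK// eqxx big1// => i.
by rewrite -val_eqE /= => i_neq; case: eqP => // iE; lia.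
Qed.

Lemma sum_config_m f : (\sum_(j in config_J f) config_m f j)%N = sumJ f.
Proof. by apply: eq_big => i; rewrite ?inE// ffunE. Qed.

Lemma admissibleP f : reflect
  ((0 < nbJ f)%N /\
   forall i : 'I_n, (i.+1 < max_pos (config_J f))%N -> config_k f i = 1%N)
  (admissible f).
Proof.
apply: (iffP andP) => [[/existsP[j0 j0J] /forallP adm]|[J_gt0 k1]].
  have J_gt0 : (0 < #|config_J f|)%N.
    by apply/card_gt0P; exists j0; rewrite inE.
  split=> [|i]; first by rewrite -card_config_J.
  rewrite /max_pos.
  have [j jJ ->] := eq_bigmax_cond (fun j : 'I_n => j.+1) J_gt0.
  rewrite ltnS => ij; move: jJ; rewrite inE => jJ.
  have /forallP/(_ i) := implyP (adm j) jJ.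
  rewrite ij /= => /eqP y0; rewrite ffunE y0.
  (* A position before an element of J is not the last one, so [config_k] adds no extra unit
     there. *)
  by case: eqP => // iE; have := ltn_ord j; lia.
split.
  move: J_gt0; rewrite -card_config_J => /card_gt0P[j]; rewrite inE => jJ.
  by apply/existsP; exists j.
apply/forallP => j; apply/implyP => jJ; apply/forallP => i; apply/implyP => ij.
have : config_k f i = 1%N.
  apply: k1; apply: (@leq_trans j.+1) => //.
  by rewrite /max_pos (bigD1 j) ?inE//= leq_maxl.
by rewrite ffunE => k1i; apply/eqP; lia.
Qed.

End Encoding.

(** Restores the factor 1 / (m_1 + ... + m_n) left out of [weight]. *)
Lemma mzv_term_config (R : realType) n (f : config n) : (0 < n)%N ->
  mzv_term R (config_k f) (config_m f) =
  weight R f * ((sumJ f + sumC f)%:R)^-1.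
Proof.
case: n f => // n f _; rewrite /mzv_term /weight -prodfV.
rewrite !big_ord_recr /= -mulrA; congr (_ * _).
  apply: eq_bigr => i _; rewrite ffunE eqSS ltn_eqF//= addn0 addn1.
  by congr (_%:R ^- _); apply: eq_bigr => j _; rewrite ffunE.
rewrite ffunE eqxx addn1 addn1.
have -> : (\sum_(j < n.+1 | (j <= n)%N) config_m f j)%N = (sumJ f + sumC f)%N.
  rewrite -sum_config; apply: eq_big => j; first by rewrite -ltnS ltn_ord.
  by rewrite ffunE.
have -> : (\sum_(j < n.+1 | (j <= n)%N) (f j).1.2.+1)%N = (sumJ f + sumC f)%N.
  by rewrite -sum_config; apply: eq_bigl => j; rewrite -ltnS ltn_ord.
by rewrite exprSr invfM mulrC.
Qed.

(** * The sums S(m, J) grouped by the size of J *)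

Section GroupedSums.
Context {R : realType}.
Local Open Scope ereal_scope.

Lemma sum_S_sum_config (n k m p : nat) : (0 < n)%N -> (0 < p)%N ->
  \sum_(J : {set 'I_n} | #|J| == p) S_sum R k m J =
  \esum_(f in [set: config n])
    (if admissible f then (weight R f)%:E *
       (if [&& nbJ f == p, (excess f + n.+1 == k)%N & sumJ f == m]
        then (((sumJ f + sumC f)%:R)^-1)%:E else 0) else 0).
Proof.
move=> n_gt0 p_gt0.
have term_ge0 kk mm : 0 <= (@mzv_term R n kk mm)%:E.
  by rewrite lee_fin invr_ge0; apply: prodr_ge0 => i _; exact: exprn_ge0.
rewrite -esum_finType; last by move=> J; rewrite /S_sum; nneg.
pose I (J : {set 'I_n}) :=
  index_set (n := n) k (max_pos J) `*`` (fun=> summation_set m J).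
transitivity (\esum_(J in [set J : {set 'I_n} | #|J| == p])
    \esum_(u in I J) (mzv_term R u.1 u.2)%:E).
  by apply: eq_esum => J _; rewrite /S_sum esum_esum.
rewrite esum_esum//.
pose D := [set f : config n | [&& admissible f, nbJ f == p,
  (excess f + n.+1 == k)%N & sumJ f == m]].
pose e (f : config n) := (config_J f, (config_k f, config_m f)).
have De f : D f <-> ([set J : {set 'I_n} | #|J| == p] `*`` I) (e f).
  split=> [/and4P[/admissibleP[_ k1] /eqP nbf /eqP exf /eqP sf]|].
    split; first by rewrite /= card_config_J nbf.
    split; split=> /=.
    - by move=> i; rewrite ffunE addn1.
    - by move=> i iE; rewrite ffunE iE eqxx addn1 addn1.
    - by rewrite sum_config_k.
    - exact: k1.
    - by move=> i; rewrite ffunE.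
    - by rewrite sum_config_m.
  move=> [/= /eqP Jp [[_ _ kE k1] [_ mE]]]; apply/and4P; split.
  - by apply/admissibleP; split=> //; rewrite -card_config_J Jp.
  - by rewrite -card_config_J Jp.
  - by rewrite -sum_config_k// kE.
  - by rewrite -sum_config_m mE.
rewrite (reindex_esum D _ e); last first.
  split=> [f /De//|f g _ _ [/setP Jfg /ffunP kfg /ffunP mfg]|].
    apply/ffunP => i; move: (Jfg i) (kfg i) (mfg i); rewrite !inE !ffunE.
    case: (f i) => -[c x] y; case: (g i) => -[c' x'] y' /= -> yy' [->].
    by congr (_, _); lia.
  move=> [J [kk mm]] Jkm.
  (* The inverse encoding; the truncated subtractions are exact because m_i >= 1, k_i >= 1 and k_n
     >= 2. *)
  pose f : config n :=
    [ffun i => (i \in J, (mm i).-1, (kk i - 1 - (i.+1 == n))%N)].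
  suff ef : e f = (J, (kk, mm)) by exists f => //; apply/De; rewrite ef.
  move: Jkm => [_ [/= [k_gt0 k_last _ _] [m_gt0 _]]].
  congr (_, (_, _)).
  - by apply/setP => i; rewrite inE ffunE.
  - apply/ffunP => i; rewrite !ffunE /=; have := k_gt0 i; have := k_last i.
    by case: eqP => [iE /(_ iE)|_ _]; lia.
  - by apply/ffunP => i; rewrite !ffunE /= prednK.
rewrite esum_mkcond; apply: eq_esum => f _.
have -> : (f \in D) = [&& admissible f, nbJ f == p,
  (excess f + n.+1 == k)%N & sumJ f == m] by apply/idP/idP; rewrite inE.
case: (admissible f) => //=; case: ifP => _; last by rewrite mule0.
by rewrite mzv_term_config// EFinM.
Qed.

(** The constraints select |J| = p + 1, s = k - n - 1 and a = m in [esum_admissible]. The remaining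
    sum over b is [esum_chain_sum], whose factor 1/m raises the exponent to k - n. *)
Lemma sum_S_sum (n k m p : nat) : (n < k)%N -> (0 < m)%N -> (p < n)%N ->
  \sum_(J : {set 'I_n} | #|J| == p.+1) S_sum R k m J =
  (chain_sum p.+1 m * complete_sum (n - p.+1) m / m%:R ^+ (k - n))%:E.
Proof.
move=> nk m_gt0 pn; rewrite sum_S_sum_config//; last exact: leq_ltn_trans pn.
rewrite (esum_admissible n (g := fun q d a b =>
  if [&& q == p.+1, (d + n.+1 == k)%N & a == m]
  then (((a + b)%:R)^-1 : R)%:E else 0)); last by nneg.
rewrite (bigD1 (Ordinal pn))//= [X in _ + X]big1 ?adde0; last first.
  move=> q qp; rewrite esum1// => a _; rewrite esum1// => b _.
  rewrite esum1// => s _; rewrite ifF ?mule0//.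
  by move: qp; rewrite -val_eqE /= eqSS => /negPf ->.
pose r : R := (chain_sum p.+1 m / m%:R ^+ (k - n.+1))%R.
pose G b := (r%:E * (chain_sum (n - p.+1) b / (m + b)%:R)%:E).
transitivity (\esum_(a in [set: nat]) if a == m then
    \esum_(b in [set: nat]) G b else 0).
  apply: eq_esum => a _; rewrite eqxx /=; case: eqVneq => [->|_]; last first.
    rewrite esum1// => b _; rewrite esum1// => s _.
    by rewrite andbF mule0.
  apply: eq_esum => b _.
  have r_ge0 : (0 <= r)%R by rewrite /r; nneg.
  rewrite -(esum_delta (t := (k - n.+1)%N) (a := fun=> G b));
    last by rewrite /G; nneg.
  apply: eq_esum => s _; rewrite andbT.
  have -> : (s + n.+1 == k)%N = (s == k - n.+1)%N by lia.
  case: eqP => [->|_]; last by rewrite mule0.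
  by rewrite /G -!EFinM /r; congr EFin; ring.
have r_ge0 : (0 <= r)%R by rewrite /r; nneg.
rewrite esum_delta; last by rewrite /G; nneg.
rewrite esumZl//; last by nneg.
rewrite esum_chain_sum// -EFinM /r; congr EFin.
have -> : (k - n = (k - n.+1).+1)%N by lia.
by rewrite exprSr invfM; ring.
Qed.

End GroupedSums.

(** * The alternating sum over all nonempty J *)

Theorem proposition1p4 (R : realType) (n k : nat) (n_gt0 : (0 < n)%N)
    (k_gt_n : (n < k)%N) (m : nat) (m_gt0 : (0 < m)%N) :
  (\sum_(J : {set 'I_n} | J != finset.set0)
     ((-1) ^+ (#|J| - 1))%:E * S_sum R k m J)%E = ((m%:R ^+ k)^-1)%:E.
Proof.
case: n n_gt0 k_gt_n => // n _ nk; case: m m_gt0 => // m _.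
(* From here [n] and [m] denote the predecessors of the original values. The sets J are grouped by p
   = |J| - 1, which fits in ['I_n.+1]. *)
rewrite (partition_big
  (fun J : {set 'I_n.+1} => inord #|J|.-1 : 'I_n.+1) xpredT)//=.
transitivity (\sum_(p < n.+1) ((-1) ^+ p * (chain_sum p.+1 m.+1 *
  complete_sum (n.+1 - p.+1) m.+1 / m.+1%:R ^+ (k - n.+1)))%:E : \bar R)%E.
  apply: eq_bigr => p _; rewrite EFinM -sum_S_sum//.
  (* The sign is constant on each group, and the sums S(m, J) are nonnegative, so it distributes
     over them in the extended reals. *)
  rewrite ge0_sume_distrr; last first.
    move=> J _; apply: esum_ge0 => kk _; apply: esum_ge0 => mm _.
    by rewrite lee_fin invr_ge0; apply: prodr_ge0 => i _; exact: exprn_ge0.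
  have cardJ (J : {set 'I_n.+1}) :
      (J != finset.set0) && (inord #|J|.-1 == p) = (#|J| == p.+1).
    rewrite -card_gt0 -val_eqE /= inordK; first by case: #|J|.
    have : (#|J| <= n.+1)%N by rewrite -[leqRHS]card_ord max_card.
    by case: #|J|.
  rewrite (eq_bigl _ _ cardJ); apply: eq_bigr => J /eqP ->.
  by rewrite subn1.
rewrite sumEFin; congr EFin.
(* The extra factor 1/(m+1) comes from rewriting [chain_sum p.+1 m.+1] as an elementary sum. *)
transitivity ((m.+1%:R * m.+1%:R ^+ (k - n.+1))^-1 * \sum_(p < n.+1)
  (-1) ^+ p * elementary_sum p m * complete_sum (n - p) m.+1 : R).
  rewrite mulr_sumr; apply: eq_bigr => p _.
  by rewrite chain_sumSS subSS invfM; ring.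
rewrite sum_elementary_complete -invfM -exprS -exprD.
by congr (_ ^- _); lia.
Qed.
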